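(* Let $(X,d)$ be a $b$-metric space with parameter $b\ge 1$ and let $\{f_n : n=1,2,\dots,N\}$ be a finite family of generalized $F$-contraction self-mappings on $X$. Define $T:\mathcal{H}(X)\to\mathcal{H}(X)$ by $$T(A)=f_1(A)\cup f_2(A)\cup\cdots\cup f_N(A)=\bigcup_{n=1}^{N} f_n(A)\quad\text{for each }A\in\mathcal{H}(X).$$ Then $T$ is a generalized $F$-contraction on $(\mathcal{H}(X),H)$.
   Context: A $b$-metric on a nonempty set $X$ with parameter $b\ge 1$ is a function $d:X\times X\to[0,\infty)$ such that for all $x,y,z\in X$: $d(x,y)=0$ if and only if $x=y$; $d(x,y)=d(y,x)$; and $d(x,y)\le b\,(d(x,z)+d(z,y))$. A sequence $\{x_n\}$ converges to $x$ if $d(x_n,x)\to 0$. A set $C\subseteq X$ is compact if every sequence in $C$ has a subsequence converging to a limit in $C$. $\mathcal{H}(X)$ is the set of all nonempty compact subsets of $X$. For $A,B\in\mathcal{H}(X)$, $H(A,B)=\max\{\sup_{b\in B}d(b,A),\ \sup_{a\in A}d(a,B)\}$, where $d(x,B)=\inf\{d(x,y):y\in B\}$; $H$ is a $b$-metric on $\mathcal{H}(X)$. For $A\subseteq X$, $f(A)=\{f(x):x\in A\}$. $\digamma$ is the collection of all continuous mappings $F:(0,\infty)\to\mathbb{R}$ such that: (F1) $F$ is strictly increasing; (F2) for every sequence $\{\alpha_n\}$ of positive reals, $\lim_{n\to\infty}\alpha_n=0$ is equivalent to $\lim_{n\to\infty}F(\alpha_n)=-\infty$; (F3) there exists $h\in(0,1)$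 with $\lim_{\alpha\to0^+}\alpha^hF(\alpha)=0$. $\Upsilon$ is the set of all mappings $\tau:(0,\infty)\to(0,\infty)$ such that $\liminf_{s\to t}\tau(s)>0$ for all $t\ge 0$. A self-mapping $f$ of a $b$-metric space $(Y,\rho)$ is called a generalized $F$-contraction if there exist $F\in\digamma$ and $\tau\in\Upsilon$ such that for all $x,y\in Y$ with $\rho(fx,fy)>0$, $\tau(\rho(x,y))+F(\rho(fx,fy))\le F(\rho(x,y))$. *)

(* Defs.v *)
From HB Require Import structures.
From mathcomp Require Import all_boot all_order all_algebra.
From mathcomp Require Import all_classical all_reals all_analysis.

Set Implicit Arguments.
Unset Strict Implicit.
Unset Printing Implicit Defensive.

Import Order.TTheory GRing.Theory Num.Theory.
Import numFieldNormedType.Exports.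

Local Open Scope classical_set_scope.
Local Open Scope ring_scope.

Record bMetricSpace (R : realType) (b : R) := BMetricSpace {
  bpoint :> Type;
  bdist : bpoint -> bpoint -> R;
  bpoint_nonempty : [set: bpoint] !=set0;
  bparam_ge1 : 1 <= b;
  bdist_ge0 : forall x y, 0 <= bdist x y;
  bdist_eq0 : forall x y, bdist x y = 0 <-> x = y;
  bdist_sym : forall x y, bdist x y = bdist y x;
  bdist_triangle : forall x y z, bdist x y <= b * (bdist x z + bdist z y)
}.

Section Sets.
Variables (R : realType) (b : R) (X : bMetricSpace b).

Definition bcvg (u : nat -> X) (x : X) : Prop :=
  bdist (u n) x @[n --> \oo] --> (0 : R).

Definition bcompact (C : set X) : Prop :=
  forall u : nat -> X, (forall n, C (u n)) ->
  exists phi : nat -> nat, {homo phi : m n / (m < n)%N} /\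
    exists2 x, C x & bcvg (u \o phi) x.

(* A real infimum over [B]; it has its usual meaning when [B] is nonempty. *)
Definition dist_set (x : X) (B : set X) : R := inf [set bdist x y | y in B].

(* The real suprema are over nonempty bounded sets when [A] and [B] are
   nonempty and compact (see [has_sup_dist_set]). *)
Definition hausdorff (A B : set X) : R :=
  Num.max (sup [set dist_set y A | y in B]) (sup [set dist_set x B | x in A]).

Record hset := HSet {
  hset_set :> set X;
  hset_nonempty : hset_set !=set0;
  hset_compact : bcompact hset_set
}.

Lemma hset_eq (A B : hset) : hset_set A = hset_set B -> A = B.
Proof.
case: A B => [A A0 cA] [B B0 cB] /= AB; subst B.
by congr HSet; exact: Prop_irrelevance.
Qed.

Let b_ge0 : 0 <= b. Proof. exact: le_trans ler01 (bparam_ge1 X). Qed.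

Lemma bdistxx (x : X) : bdist x x = 0.
Proof. by apply/bdist_eq0. Qed.

Lemma dist_set_ge0 (x : X) (B : hset) : 0 <= dist_set x B.
Proof.
apply: lb_le_inf; first by have [y By] := hset_nonempty B; exists (bdist x y), y.
by move=> _ [y _ <-]; exact: bdist_ge0.
Qed.

Lemma dist_set_le (x y : X) (B : set X) : B y -> dist_set x B <= bdist x y.
Proof.
move=> By; apply: ge_inf; last by exists y.
by exists 0 => _ [z _ <-]; exact: bdist_ge0.
Qed.

Lemma dist_set_lt (x : X) (B : hset) (e : R) :
  dist_set x B < e -> exists2 y, hset_set B y & bdist x y < e.
Proof.
move=> xe; have : has_inf [set bdist x y | y in (B : set X)].
  split; first by have [y By] := hset_nonempty B; exists (bdist x y), y.
  by exists 0 => _ [z _ <-]; exact: bdist_ge0.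
have e0 : 0 < e - dist_set x B by rewrite subr_gt0.
move=> /(inf_adherent e0) [_ [y By <-]].
by rewrite -/(dist_set x B) addrC subrK => ?; exists y.
Qed.

Lemma bcompact_bounded (C : set X) (x : X) :
  bcompact C -> exists M : R, forall y, C y -> bdist x y <= M.
Proof.
move=> cC; apply: contrapT => noM.
have H (n : nat) : exists y, C y /\ n%:R < bdist x y.
  apply: contrapT => noy; apply: noM; exists n%:R => y Cy.
  by rewrite leNgt; apply/negP => ny; apply: noy; exists y.
have [u Hu] := choice H.
have [phi [phi_incr [l Cl ul]]] := cC u (fun n => (Hu n).1).
have phi_ge n : (n <= phi n)%N.
  by elim: n => // n ih; apply: leq_ltn_trans ih _; exact: phi_incr.
have near_l : \forall n \near \oo, bdist (u (phi n)) l < 1.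
  exact: (@cvgr_lt _ _ _ _ (fun n => bdist (u (phi n)) l) 0 ul 1 ltr01).
have : \forall n \near \oo, b * (bdist x l + 1) <= n%:R.
  exact: nbhs_infty_ger.
move=> big; have [n [n1 n2]] := filter_ex (filterI near_l big).
have := bdist_triangle x (u (phi n)) l.
apply/negP; rewrite -ltNge.
apply: le_lt_trans (_ : _ <= n%:R) _.
  by apply: le_trans n2; rewrite ler_wpM2l// lerD2l bdist_sym ltW.
by apply: le_lt_trans (Hu (phi n)).2; rewrite ler_nat.
Qed.

Lemma has_sup_dist_set (A B : hset) :
  has_sup [set dist_set x B | x in (A : set X)].
Proof.
have [a Aa] := hset_nonempty A; have [y By] := hset_nonempty B.
split; first by exists (dist_set a B), a.
have [M HM] := bcompact_bounded y (@hset_compact A).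
exists M => _ [x Ax <-]; apply: le_trans (dist_set_le _ By) _.
by rewrite bdist_sym; exact: HM.
Qed.

Lemma hausdorff_sym (A B : hset) : hausdorff A B = hausdorff B A.
Proof. by rewrite /hausdorff maxC. Qed.

Lemma dist_set_hausdorff (A B : hset) (x : X) :
  hset_set A x -> dist_set x B <= hausdorff A B.
Proof.
move=> Ax; rewrite /hausdorff le_max; apply/orP; right.
by apply: ub_le_sup; [exact: (has_sup_dist_set A B).2 | exists x].
Qed.

Lemma hausdorff_le (A B : hset) (M : R) :
  (forall x, hset_set A x -> dist_set x B <= M) ->
  (forall y, hset_set B y -> dist_set y A <= M) -> hausdorff A B <= M.
Proof.
move=> AM BM; rewrite /hausdorff ge_max; apply/andP; split.
  by apply: ge_sup; [exact: (has_sup_dist_set B A).1 | move=> _ [y By <-]; exact: BM].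
by apply: ge_sup; [exact: (has_sup_dist_set A B).1 | move=> _ [x Ax <-]; exact: AM].
Qed.

Lemma hausdorff_ge0 (A B : hset) : 0 <= hausdorff A B.
Proof.
have [x Ax] := hset_nonempty A.
exact: le_trans (dist_set_ge0 x B) (dist_set_hausdorff B Ax).
Qed.

Lemma dist_set0_mem (x : X) (B : hset) : dist_set x B = 0 -> hset_set B x.
Proof.
move=> xB0; have H (n : nat) : exists y, hset_set B y /\ bdist x y < n.+1%:R^-1.
  have [|y By ?] := @dist_set_lt x B n.+1%:R^-1; last by exists y.
  by rewrite xB0 invr_gt0.
have [u Hu] := choice H.
have [phi [phi_incr [l Bl ul]]] := @hset_compact B u (fun n => (Hu n).1).
suff -> : x = l by [].
have phi_ge n : (n <= phi n)%N.
  by elim: n => // n ih; apply: leq_ltn_trans ih _; exact: phi_incr.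
apply/bdist_eq0/eqP; rewrite eq_le bdist_ge0 andbT.
have lim0 : b * (n.+1%:R^-1 + bdist (u (phi n)) l) @[n --> \oo] --> (0 : R).
  rewrite -(mulr0 b) -[X in b * X](addr0 0).
  by apply: cvgMl_tmp; apply: cvgD => //; exact: cvg_harmonic.
apply: (cvgr_to_ge lim0); near=> n.
apply: le_trans (bdist_triangle x l (u (phi n))) _.
rewrite ler_wpM2l// lerD2r; apply: le_trans (ltW (Hu (phi n)).2) _.
by rewrite lef_pV2 ?posrE// ler_nat ltnS.
Unshelve. all: by end_near.
Qed.

Lemma hausdorff_eq0 (A B : hset) : hausdorff A B = 0 <-> A = B.
Proof.
have sub (A' B' : hset) : hausdorff A' B' = 0 -> hset_set A' `<=` hset_set B'.
  move=> AB0 x Ax; apply: dist_set0_mem; apply/eqP.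
  by rewrite eq_le dist_set_ge0 andbT -AB0 dist_set_hausdorff.
split=> [AB0|->].
  apply/hset_eq/seteqP; split; apply: sub => //.
  by rewrite hausdorff_sym.
apply/eqP; rewrite eq_le hausdorff_ge0 andbT.
by apply: hausdorff_le => x Bx; rewrite -(bdistxx x); exact: dist_set_le.
Qed.

Lemma hausdorff_triangle (A B C : hset) :
  hausdorff A B <= b * (hausdorff A C + hausdorff C B).
Proof.
have H (A' B' : hset) x : hset_set A' x ->
    dist_set x B' <= b * (hausdorff A' C + hausdorff C B').
  move=> Ax; have lim : b * ((hausdorff A' C + n.+1%:R^-1) +
      (hausdorff C B' + n.+1%:R^-1)) @[n --> \oo] -->
      b * ((hausdorff A' C + 0) + (hausdorff C B' + 0)).
    by apply: cvgMl_tmp; apply: cvgD; apply: cvgD;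
      (exact: cvg_cst || exact: cvg_harmonic).
  rewrite -[X in b * (X + _)]addr0 -[X in b * (_ + X)]addr0.
  apply: (cvgr_to_ge lim); near=> n.
  have [|c Cc xc] := @dist_set_lt x C (hausdorff A' C + n.+1%:R^-1).
    by apply: le_lt_trans (dist_set_hausdorff C Ax) _; rewrite ltrDl invr_gt0.
  have [|y By cy] := @dist_set_lt c B' (hausdorff C B' + n.+1%:R^-1).
    by apply: le_lt_trans (dist_set_hausdorff B' Cc) _; rewrite ltrDl invr_gt0.
  apply: le_trans (dist_set_le x By) _.
  apply: le_trans (bdist_triangle x y c) _.
  by rewrite ler_wpM2l// lerD// ltW.
apply: hausdorff_le => [x Ax|y By]; first exact: H.
by rewrite addrC (hausdorff_sym A) (hausdorff_sym C); exact: H.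
Unshelve. all: by end_near.
Qed.

Lemma hset_inhabited : [set: hset] !=set0.
Proof.
have [x _] := bpoint_nonempty X.
have cx : bcompact [set x].
  move=> u ux; exists id; split=> //; exists x => //.
  rewrite /bcvg (_ : (fun n => _) = fun=> 0); first exact: cvg_cst.
  by apply/funext => n /=; rewrite ux bdistxx.
by exists (HSet (ex_intro _ x erefl) cx).
Qed.

Definition hyperspace : bMetricSpace b :=
  @BMetricSpace R b hset hausdorff hset_inhabited (bparam_ge1 X)
    hausdorff_ge0 hausdorff_eq0 hausdorff_sym hausdorff_triangle.

End Sets.

(* Functions on (0, +oo) are represented by functions on R constrained only at
   positive arguments; their values elsewhere are irrelevant. *)
Record digamma_class (R : realType) (F : R -> R) : Prop := {
  digamma_continuous : {in `]0, +oo[, continuous F};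
  digamma_increasing : {in `]0, +oo[ &, {homo F : x y / x < y}};
  digamma_cvg0 : forall alpha : nat -> R, (forall n, 0 < alpha n) ->
    (alpha n @[n --> \oo] --> (0 : R)) <->
    (F (alpha n) @[n --> \oo] --> -oo);
  digamma_power : exists2 h : R, 0 < h < 1 &
    alpha `^ h * F alpha @[alpha --> 0^'+] --> (0 : R)
}.

(* The lower limit is taken as s tends to t within (0, +oo) \ {t}. *)
Definition upsilon_class (R : realType) (tau : R -> R) : Prop :=
  (forall s : R, 0 < s -> 0 < tau s) /\
  forall t : R, 0 <= t ->
    (0 < limf_einf (EFin \o tau) (within `]0%R, +oo[%classic t^'))%E.

Definition generalized_F_contraction (R : realType) (b : R)
    (Y : bMetricSpace b) (f : Y -> Y) : Prop :=
  exists F tau : R -> R, [/\ digamma_class F, upsilon_class tau &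
    forall x y : Y, 0 < bdist (f x) (f y) ->
      tau (bdist x y) + F (bdist (f x) (f y)) <= F (bdist x y)].

(* Main.v *)
Require Import Defs.
From mathcomp Require Import all_boot all_order all_algebra.
From mathcomp Require Import all_classical all_reals all_analysis.

Set Implicit Arguments.
Unset Strict Implicit.
Unset Printing Implicit Defensive.

Import Order.TTheory GRing.Theory Num.Theory.
Import numFieldNormedType.Exports.
Local Open Scope classical_set_scope.
Local Open Scope ring_scope.

(** Each f n comes with its own pair (F n, tau n), so a pair common to all the maps
    is needed first. The sum F of the F n works: a generalized F-contraction
    shrinks distances, so for t = d (f n x) (f n y) < s = d x y every summand of
    F s - F t is nonnegative, while the n-th one is at least tau n s. The sum stays
    admissible ([digamma_sum]). For the lower bound, local positivity of the lower
    limits and compactness of [0, s + 1] show that the infimum sigma s of all the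
    tau n over ]0, s + 1] is positive; it is nonincreasing in s, hence it is
    admissible as well ([upsilon_common_minorant]).

    The images T A are compact because the maps are nonexpansive
    ([bcompact_bigcup_image]). For the contraction inequality, a b-metric need not be
    continuous, so the extrema in the definition of H need not be attained and the
    estimate is made up to e > 0. Put h = H(A, B) and L = H(T A, T B). Some point
    f n a of one image is at distance more than L - e from the other image, and some
    y in the other set has d a y < h + e; then d (f n a) (f n y) > L - e, so that
    sigma h + F (L - e) <= F (h + e) ([dist_set_image_le]). Here
    sigma h bounds tau n (d a y) from below although d a y may exceed h, because the
    infimum runs up to h + 1 and e <= 1. Continuity of F gives the claim as e tends to 0. *)

(** * The class of admissible functions F *)

(** Condition (F3) persists when the exponent grows, since alpha `^ k <= alpha `^ h
    for alpha in ]0, 1] and h <= k. *)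
Lemma digamma_power_le (R : realType) (F : R -> R) (h k : R) : h <= k ->
  alpha `^ h * F alpha @[alpha --> 0^'+] --> (0 : R) ->
  alpha `^ k * F alpha @[alpha --> 0^'+] --> (0 : R).
Proof.
move=> hk /cvgrPdist_le Fh; apply/cvgrPdist_le => e e0.
near=> x.
have x0 : 0 < x by near: x; exact: nbhs_right_gt.
have x1 : x <= 1 by near: x; exact: nbhs_right_le.
have : `|0 - x `^ h * F x| <= e by near: x; exact: Fh.
apply: le_trans; rewrite !sub0r !normrN !normrM ler_wpM2r//.
by rewrite !ger0_norm ?powR_ge0// ger_powR// x0.
Unshelve. all: by end_near. Qed.

Lemma digammaD (R : realType) (F G : R -> R) :
  digamma_class F -> digamma_class G -> digamma_class (fun x => F x + G x).
Proof.
move=> [Fc Fi F0 [h /andP[h0 h1] Fh]] [Gc Gi G0 [k /andP[k0 k1] Gk]].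
split.
- by move=> x x0; apply: cvgD; [exact: Fc | exact: Gc].
- by move=> x y x0 y0 xy; apply: ltrD; [exact: Fi | exact: Gi].
- move=> u u0; split=> [u_cvg|/cvgrNyPle FGy].
    have /cvgrNyPle Fy := (F0 u u0).1 u_cvg.
    have /cvgrNyPle Gy := (G0 u u0).1 u_cvg.
    apply/cvgrNyPle => A; near=> n.
    rewrite -[leRHS]addr0; apply: lerD.
      by near: n; exact: Fy.
    by near: n; exact: Gy.
  (* if e < u n then F (u n) + G (u n) > F e + G e, which fails for large n *)
  apply/cvgrPdist_le => e e0; near=> n.
  rewrite sub0r normrN ger0_norm; last exact: ltW.
  rewrite leNgt; apply/negP => eu.
  have : F (u n) + G (u n) <= F e + G e by near: n; exact: FGy.
  apply/negP; rewrite -ltNge; apply: ltrD.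
    by apply: Fi => //; rewrite in_itv/= andbT.
  by apply: Gi => //; rewrite in_itv/= andbT.
- exists (Num.max h k); first by rewrite lt_max h0/= gt_max h1.
  under eq_fun do rewrite mulrDr.
  apply: (@cvg_trans _ (nbhs (0 + 0 : R))); last by rewrite addr0.
  apply: cvgD.
    by apply: (digamma_power_le _ Fh); rewrite le_max lexx.
  by apply: (digamma_power_le _ Gk); rewrite le_max lexx orbT.
Unshelve. all: by end_near. Qed.

Lemma digamma_sum (R : realType) (N : nat) (F : 'I_N.+1 -> R -> R) :
  (forall n, digamma_class (F n)) -> digamma_class (fun x => \sum_n F n x).
Proof.
elim: N F => [|N IH] F hF.
  rewrite (_ : (fun x => _) = F ord0); first exact: hF.
  by apply/funext => x; rewrite big_ord1.
under eq_fun do rewrite big_ord_recl.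
by apply: digammaD; [exact: hF | apply: IH => n; exact: hF].
Qed.

Lemma digamma_le (R : realType) (F : R -> R) (x y : R) : digamma_class F ->
  0 < x -> x <= y -> F x <= F y.
Proof.
move=> hF x0; rewrite le_eqVlt => /predU1P[->//|xy].
apply/ltW/(digamma_increasing hF) => //; rewrite in_itv/= andbT//.
exact: lt_trans xy.
Qed.

Lemma digamma_lt_cancel (R : realType) (F : R -> R) (x y : R) :
  digamma_class F -> 0 < y -> F x < F y -> x < y.
Proof.
move=> hF y0 Fxy; rewrite ltNge; apply/negP => yx.
by have := digamma_le hF y0 yx; rewrite leNgt Fxy.
Qed.

(** * The class of admissible functions tau *)

(** The lower limit only sees s <> t; the value tau t > 0 covers s = t when t > 0. *)
Lemma upsilon_near (R : realType) (tau : R -> R) (t : R) :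
  upsilon_class tau -> 0 <= t ->
  exists2 c, 0 < c & \forall s \near t, 0 < s -> c <= tau s.
Proof.
move=> [tau_gt0 tau_lim] t0.
have := tau_lim t t0; rewrite limf_einfE => /ereal_sup_gt[_ [V Vt <-]] infV.
have [c c0 cV] : exists2 c : R, 0 < c & forall s, V s -> c <= tau s.
  have lbV s : V s -> (ereal_inf [set (EFin \o tau) x | x in V] <= (tau s)%:E)%E.
    by move=> Vs; apply: ereal_inf_lbound; exists s.
  move: infV lbV; case: (ereal_inf _) => [r| |] // r0 lbV.
    by exists r => // s /lbV; rewrite lee_fin.
  (* the infimum is +oo only when V is empty, so any positive c will do *)
  by exists 1 => // s /lbV; rewrite leye_eq.
have tc : 0 < Num.min c (if 0 < t then tau t else 1).
  by rewrite lt_min c0/=; case: ifPn => // /tau_gt0.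
exists (Num.min c (if 0 < t then tau t else 1)) => //.
near=> s => s0; rewrite ge_min.
have [st|st] := eqVneq s t; first by rewrite -st s0 lexx orbT.
apply/orP; left; apply: cV.
have : s != t -> `]0, +oo[%classic s -> V s by near: s; exact: Vt.
by apply => //=; rewrite in_itv/= s0.
Unshelve. all: by end_near. Qed.

(** A finite family in the class is uniformly bounded below by a positive
    constant on ]0, K]: each lower limit gives a local bound, and the
    segment [0, K] is compact. *)
Lemma upsilon_bounded_below (R : realType) (I : finType) (tau : I -> R -> R)
    (K : R) : (forall i, upsilon_class (tau i)) ->
  exists2 c, 0 < c & forall i s, 0 < s <= K -> c <= tau i s.
Proof.
move=> htau.
have /compact_near_coveringP cov := @segment_compact R 0 K.
have : \forall c \near 0^'+,
    `[0, K]%classic `<=` (fun s => 0 < s -> forall i, c <= tau i s).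
  apply: cov => t /=; rewrite in_itv/= => /andP[t0 _].
  have H i : exists c, 0 < c /\ \forall s \near t, 0 < s -> c <= tau i s.
    by have [c c0 ?] := upsilon_near (htau i) t0; exists c.
  have [c hc] := choice H.
  exists ([set s | forall i, 0 < s -> c i <= tau i s],
          [set e | forall i, e <= c i]).
    split=> /=.
      apply: (@filter_forall _ _ (fun i s => 0 < s -> c i <= tau i s)
        (nbhs (t : R))) => i; exact: (hc i).2.
    apply: (@filter_forall _ _ (fun i e => e <= c i) (0 : R)^'+) => i.
    exact: nbhs_right_le (hc i).1.
  by move=> [s e] /= [cs ec] s0 i; apply: le_trans (ec i) (cs i s0).
move=> /filterI/(_ (nbhs_right_gt 0))/filter_ex[c [cK c0]].
exists c => // i s /andP[s0 sK]; apply: cK => //=.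
by rewrite in_itv/= (ltW s0).
Qed.

(** The value tau (t + 1) is a lower bound of tau near t, also for t = 0. *)
Lemma upsilon_nonincreasing (R : realType) (tau : R -> R) :
  (forall s, 0 < s -> 0 < tau s) ->
  (forall s t, 0 < s -> s <= t -> tau t <= tau s) -> upsilon_class tau.
Proof.
move=> tau_gt0 tau_le; split=> // t t0; rewrite limf_einfE.
have t10 : 0 < t + 1 by rewrite ltr_wpDl.
apply: (@lt_le_trans _ _ (tau (t + 1))%:E); first by rewrite lte_fin tau_gt0.
pose V := [set s : R | 0 < s <= t + 1].
apply: (@le_trans _ _ (ereal_inf [set (EFin \o tau) x | x in V])).
  apply: le_ereal_inf_tmp => _ [s /andP[s0 st] <-].
  by rewrite lee_fin tau_le.
apply: ereal_sup_ubound; exists V => //.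
have tt1 : t < t + 1 by rewrite ltrDl.
apply: filterS (lt_le_nbhsl tt1) => s st _ /=.
by rewrite in_itv/= andbT /V/= => ->.
Qed.

(** The witness sigma s is the infimum of all the tau n over ]0, s + 1]; the
    enlargement by 1 leaves room for arguments slightly larger than s. *)
Lemma upsilon_common_minorant (R : realType) (N : nat)
    (tau : 'I_N.+1 -> R -> R) : (forall n, upsilon_class (tau n)) ->
  exists2 sigma : R -> R, upsilon_class sigma &
    forall n s x, 0 < x <= s + 1 -> sigma s <= tau n x.
Proof.
move=> htau.
pose D s := [set y | exists n x, 0 < x <= s + 1 /\ y = tau n x].
have lbD s : has_lbound (D s).
  exists 0 => _ [n [x [/andP[x0 _] ->]]]; exact/ltW/((htau n).1 x x0).
have D0 s : 0 < s -> D s !=set0.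
  move=> s0; exists (tau ord0 s), ord0, s; split => //.
  by rewrite s0 lerDl ler01.
exists (fun s => inf (D s)); last first.
  by move=> n s x xs; apply: ge_inf => //; exists n, x.
apply: upsilon_nonincreasing => [s s0|s t s0 st].
  have [c c0 cK] := upsilon_bounded_below (s + 1) htau.
  apply: lt_le_trans c0 _; apply: lb_le_inf; first exact: D0.
  by move=> _ [n [x [xs ->]]]; exact: cK.
apply: lb_le_inf; first exact: D0.
move=> _ [n [x [/andP[x0 xs] ->]]]; apply: ge_inf => //; exists n, x; split=> //.
by rewrite x0 (le_trans xs)// lerD2r.
Qed.

(** * Families of generalized F-contractions *)

Lemma bdist_gt0 (R : realType) (b : R) (X : bMetricSpace b) (x y : X) :
  x <> y -> 0 < bdist x y.
Proof.
move=> xy; rewrite lt_neqAle bdist_ge0 andbT eq_sym.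
by apply/eqP => /bdist_eq0.
Qed.

Lemma bdist_gt0_map (R : realType) (b : R) (X : bMetricSpace b) (f : X -> X)
    (x y : X) : 0 < bdist (f x) (f y) -> 0 < bdist x y.
Proof.
move=> fxy; apply: bdist_gt0 => xy.
by move: fxy; rewrite xy bdistxx ltxx.
Qed.

Lemma generalized_F_contraction_nonexpansive (R : realType) (b : R)
    (X : bMetricSpace b) (f : X -> X) : generalized_F_contraction f ->
  forall x y, bdist (f x) (f y) <= bdist x y.
Proof.
move=> [F [tau [hF [tau_gt0 _] hf]]] x y.
have [fxy|] := ltP 0 (bdist (f x) (f y)); last first.
  by move=> /le_trans; apply; exact: bdist_ge0.
have xy := bdist_gt0_map fxy.
apply/ltW/(digamma_lt_cancel hF) => //; apply: lt_le_trans (hf _ _ fxy).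
by rewrite ltrDr tau_gt0.
Qed.

(** A pair (F, sigma) that serves all the maps of a finite family. The bound is
    sigma s for every s >= d x y - 1, not only for s = d x y. *)
Lemma generalized_F_contraction_common (R : realType) (b : R)
    (X : bMetricSpace b) (N : nat) (f : 'I_N.+1 -> X -> X) :
  (forall n, generalized_F_contraction (f n)) ->
  exists F sigma : R -> R, [/\ digamma_class F, upsilon_class sigma &
    forall n (x y : X) s, 0 < bdist (f n x) (f n y) -> bdist x y <= s + 1 ->
      sigma s + F (bdist (f n x) (f n y)) <= F (bdist x y)].
Proof.
move=> hf; have [F hF] := choice hf; have [tau hFt] := choice hF.
have htau n : upsilon_class (tau n) by case: (hFt n).
have [sigma hsigma le_sigma] := upsilon_common_minorant htau.
exists (fun x => \sum_n F n x), sigma; split=> //.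
  by apply: digamma_sum => n; case: (hFt n).
move=> n x y s fxy xys.
have xy := bdist_gt0_map fxy.
rewrite (bigD1 n)//= [leRHS](bigD1 n)//= addrA; apply: lerD.
  have [_ _ /(_ _ _ fxy)] := hFt n; apply: le_trans.
  by rewrite lerD2r le_sigma// xy.
apply: ler_sum => m _; apply: digamma_le => //; first by case: (hFt m).
exact: generalized_F_contraction_nonexpansive.
Qed.

(** * Images of compact sets *)

Lemma increasing_cvg_infty (phi : nat -> nat) :
  {homo phi : m n / (m < n)%N} -> phi @ \oo --> \oo.
Proof.
move=> phi_incr P [M _ MP]; exists M => // n /= Mn; apply: MP => /=.
apply: leq_trans Mn _; elim: n => // n ih.
exact: leq_ltn_trans ih (phi_incr _ _ (ltnSn n)).
Qed.

(** Infinite pigeonhole principle: a sequence in a finite type has a constant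
    subsequence. *)
Lemma constant_subsequence (I : finType) (u : nat -> I) :
  exists i (phi : nat -> nat), {homo phi : m n / (m < n)%N} /\
    forall k, u (phi k) = i.
Proof.
have [i Hi] : exists i, forall m, exists k, (m <= k)%N /\ u k = i.
  apply: contrapT => noi.
  have : \forall k \near \oo, forall i, u k <> i.
    apply: filter_forall => i; apply: contrapT => ni; apply: noi.
    exists i => m; apply: contrapT => nk; apply: ni.
    by exists m => // k /= mk uk; apply: nk; exists k.
  by move=> /filter_ex[k /(_ (u k))].
have [g Hg] := choice Hi.
pose fix phi k := if k is k'.+1 then g (phi k').+1 else g 0%N.
exists i, phi; split; last by case=> [|k] /=; exact: (Hg _).2.
by apply: homo_ltn => [|k]; [exact: ltn_trans | exact: (Hg _).1].
Qed.

(** Extract first a subsequence along which the preimages in A converge, then one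
    along which a single map f i is used. *)
Lemma bcompact_bigcup_image (R : realType) (b : R) (X : bMetricSpace b)
    (I : finType) (f : I -> X -> X) (A : set X) :
  (forall i x y, bdist (f i x) (f i y) <= bdist x y) ->
  bcompact A -> bcompact (\bigcup_(i in [set: I]) (f i @` A)).
Proof.
move=> f_le cA u uA.
have H k : exists p : I * X, A p.2 /\ f p.1 p.2 = u k.
  by have [i _ [a Aa fa]] := uA k; exists (i, a).
have [p Hp] := choice H.
have [phi [phi_incr [a Aa phi_a]]] := cA (snd \o p) (fun k => (Hp k).1).
have [i [psi [psi_incr psi_i]]] := constant_subsequence (fst \o p \o phi).
exists (phi \o psi); split; first by move=> m n mn; exact/phi_incr/psi_incr.
exists (f i a); first by exists i => //; exists a.
have lim := cvg_comp psi _ (increasing_cvg_infty psi_incr) phi_a.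
apply: squeeze_cvgr (cvg_cst 0) lim; apply: nearW => n /=.
by rewrite bdist_ge0/= -(Hp _).2 [(p _).1]psi_i f_le.
Qed.

(** * The Hausdorff estimate *)

(** Letting e tend to 0 in the perturbed inequality, by continuity of F. *)
Lemma digamma_limit_le (R : realType) (F : R -> R) (c x y : R) :
  digamma_class F -> 0 < x -> 0 < y ->
  (\forall e \near 0^'+, c + F (x - e) <= F (y + e)) -> c + F x <= F y.
Proof.
move=> hF x0 y0.
have Fx : F (x - e) @[e --> 0^'+] --> F x.
  apply: cvg_at_right_filter.
  apply: (@cvg_comp _ _ _ (fun e : R => x - e) F _ (nbhs x)).
    apply: (@cvg_trans _ (nbhs (x - 0))); last by rewrite subr0.
    apply: cvgB; [exact: cvg_cst | exact: cvg_id].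
  by apply: (digamma_continuous hF); rewrite in_itv/= andbT.
have Fy : F (y + e) @[e --> 0^'+] --> F y.
  apply: cvg_at_right_filter.
  apply: (@cvg_comp _ _ _ (fun e : R => y + e) F _ (nbhs y)).
    apply: (@cvg_trans _ (nbhs (y + 0))); last by rewrite addr0.
    apply: cvgD; [exact: cvg_cst | exact: cvg_id].
  by apply: (digamma_continuous hF); rewrite in_itv/= andbT.
by apply: ler_cvg_to => //; apply: cvgD => //; exact: cvg_cst.
Qed.

(** The one-sided estimate, for a point x of an image f i (A) that is farther than l
    from TB, where TB contains all the images f i (B). *)
Lemma dist_set_image_le (R : realType) (b : R) (X : bMetricSpace b)
    (I : Type) (f : I -> X -> X) (F : R -> R) (c K l e : R) (A B TB : hset X)
    (x : X) :
  digamma_class F ->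
  (forall i (x y : X), 0 < bdist (f i x) (f i y) -> bdist x y <= K ->
      c + F (bdist (f i x) (f i y)) <= F (bdist x y)) ->
  (forall i y, hset_set B y -> hset_set TB (f i y)) ->
  0 < e -> hausdorff A B + e <= K -> 0 < l ->
  (\bigcup_(i in [set: I]) (f i @` A)) x -> l < dist_set x TB ->
  c + F l <= F (hausdorff A B + e).
Proof.
move=> hF hf fTB e0 eK l0 [i _ [a Aa <-]] lx.
have [y By ay] : exists2 y, hset_set B y & bdist a y < hausdorff A B + e.
  apply: dist_set_lt; apply: le_lt_trans (dist_set_hausdorff B Aa) _.
  by rewrite ltrDl.
have lf : l < bdist (f i a) (f i y).
  by apply: lt_le_trans lx _; apply: dist_set_le; exact: fTB.
have fay : 0 < bdist (f i a) (f i y) := lt_trans l0 lf.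
apply: (@le_trans _ _ (F (bdist a y))); last first.
  by apply: digamma_le => //; [exact: bdist_gt0_map fay | exact: ltW].
apply: le_trans (hf i _ _ fay _); last exact: le_trans (ltW ay) eK.
by rewrite lerD2l; apply: digamma_le => //; exact: ltW.
Qed.

Theorem theorem1p10 (R : realType) (b : R) (X : bMetricSpace b)
    (N : nat) (N_gt0 : (0 < N)%N) (f : 'I_N -> X -> X)
    (hf : forall n : 'I_N, generalized_F_contraction (f n)) :
  exists T : hyperspace X -> hyperspace X,
    (forall A : hset X, (T A : hset X) = \bigcup_(n in [set: 'I_N]) (f n @` A) :> set X) /\
    generalized_F_contraction T.
Proof.
case: N N_gt0 f hf => // N _ f hf.
have TA0 (A : hset X) : \bigcup_(n in [set: 'I_N.+1]) (f n @` A) !=set0.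
  by have [a Aa] := hset_nonempty A; exists (f ord0 a), ord0 => //; exists a.
have cTA (A : hset X) : bcompact (\bigcup_(n in [set: 'I_N.+1]) (f n @` A)).
  apply: bcompact_bigcup_image (@hset_compact _ _ _ A) => n.
  exact: generalized_F_contraction_nonexpansive.
pose T (A : hyperspace X) : hyperspace X := HSet (TA0 A) (cTA A).
exists T; split=> //.
have [F [sigma [hF hsigma le_sigma]]] :=
  generalized_F_contraction_common hf.
exists F, sigma; split=> // A B TAB.
have AB : 0 < bdist A B := bdist_gt0_map TAB.
apply: digamma_limit_le => //; near=> e.
have e0 : 0 < e by near: e; exact: nbhs_right_gt.
have e1 : e <= 1 by near: e; exact: nbhs_right_le.
have eT : 0 < bdist (T A) (T B) - e.
  by rewrite subr_gt0; near: e; exact: nbhs_right_lt.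
set h := bdist A B; set l := bdist (T A) (T B) - e.
have hK : h + e <= h + 1 by rewrite lerD2l.
have hfh n (x y : X) := le_sigma n x y h.
have fT (C : hset X) n y : hset_set C y -> hset_set (T C) (f n y).
  by move=> Cy; exists n => //; exists y.
(* otherwise every point of either image is within l of the other image,
   so that H (T A) (T B) <= l, although l = H (T A) (T B) - e *)
rewrite leNgt; apply/negP => small.
suff : hausdorff (T A : hset X) (T B : hset X) <= l.
  by apply/negP; rewrite -ltNge /l ltrBlDr ltrDl.
apply: hausdorff_le => x Tx; rewrite leNgt; apply/negP => lx.
  have := dist_set_image_le hF hfh (fT B) e0 hK eT Tx lx.
  by rewrite leNgt small.
have hK' : hausdorff (B : hset X) A + e <= h + 1 by rewrite hausdorff_sym.
have := dist_set_image_le hF hfh (fT A) e0 hK' eT Tx lx.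
by rewrite hausdorff_sym leNgt small.
Unshelve. all: by end_near. Qed.
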